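(* Let $(V,|0\rangle,T,Y)$ be a vertex algebra. Then for all homogeneous $a,b\in V$, $$Y(a,z)b=p(a,b)\,e^{zT}\,Y(b,-z)a .$$
   Context: All vector spaces are over $\mathbb{C}$. A superspace is a $\mathbb{Z}_2$-graded space $V=V_{\bar 0}\oplus V_{\bar 1}$; for homogeneous $a,b$ put $p(a,b)=(-1)^{p(a)p(b)}$. An $\mathrm{End}(V)$-valued formal distribution $a(z)=\sum_{n\in\mathbb{Z}}a_{(n)}z^{-n-1}$ (all modes of the same parity) is a field if $a(z)v\in V[[z]][z^{-1}]$ for all $v\in V$. A pair is local if $(z-w)^N[a(z),b(w)]=0$ for some $N\ge0$, where $[a(z),b(w)]=a(z)b(w)-p(a,b)b(w)a(z)$; a local family is a set in which all pairs are local. A vertex algebra $(V,|0\rangle,T,Y)$ consists of a superspace $V$, a vector $|0\rangle\in V_{\bar 0}$, an even endomorphism $T$ of $V$, and a linear parity-preserving map $Y(\cdot,z)$ from $V$ to $\mathrm{End}(V)$-valued fields, $Y(a,z)=\sum_n a_{(n)}z^{-n-1}$, such that: $Y(|0\rangle,z)=\mathrm{Id}_V$, $Y(a,z)|0\rangle\in a+zV[[z]]$, $T|0\rangle=0$; $[T,Y(a,z)]=\partial_zY(a,z)$; $\{Y(a,z)\mid a\in V\}$ is a local family (for homogeneous $a,b$). *)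

(* Defs.v *)
(* MathComp world, with the classical layer of MathComp-Analysis. *)
From HB Require Import structures.
From mathcomp Require Import all_boot all_order all_algebra.
From mathcomp Require Import all_classical all_reals.
From mathcomp Require Export complex.

Set Implicit Arguments.
Unset Strict Implicit.
Unset Printing Implicit Defensive.

Import Order.TTheory GRing.Theory Num.Theory.
Local Open Scope classical_set_scope.
Local Open Scope ring_scope.

(* Z/2 is bool: false is the even class, true the odd one. *)
Record superspace (K : fieldType) := Superspace {
  space :> lmodType K;
  homog : bool -> set space;
  homog0 : forall i, homog i 0;
  homog_linear : forall i c u v, homog i u -> homog i v -> homog i (c *: u + v);
  homog_span : forall v, exists u0 u1,
    [/\ homog false u0, homog true u1 & v = u0 + u1];
  homog_direct : forall v, homog false v -> homog true v -> v = 0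
}.

Section FormalDistributions.
Variables (K : fieldType) (V : superspace K).
Implicit Types (a b : int -> {linear V -> V}) (T : {linear V -> V}).

(* p(a,b) for elements of parities i and j. *)
Definition psign (i j : bool) : K := (-1) ^+ (i && j).

Definition has_parity (i : bool) (A : V -> V) : Prop :=
  forall j v, homog j v -> homog (i (+) j) (A v).

(* A formal distribution in z (resp. in z and w) with values in U is given by
   its coefficients: f m is the coefficient of z^m (resp. f m n is the
   coefficient of z^m w^n).  An End(V)-valued distribution is entered through
   its modes, a n = a_(n), so that the coefficient of z^m in a(z) is
   a_(-m-1). *)
Definition dist a : int -> (V -> V) := fun m => a (- m - 1).

Definition app a (v : V) : int -> V := fun m => dist a m v.

(* f belongs to V[[z]][z^-1]. *)
Definition laurent (f : int -> V) : Prop :=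
  exists N : int, forall m, m < N -> f m = 0.

Definition is_field a : Prop := forall v, laurent (app a v).

Definition supercommutator (e : K) a b : int -> int -> (V -> V) :=
  fun m n => (dist a m \o dist b n) - e *: (dist b n \o dist a m).

Definition mul_zw (f : int -> int -> (V -> V)) : int -> int -> (V -> V) :=
  fun m n => f (m - 1) n - f m (n - 1).

(* (z-w)^N [a(z),b(w)] = 0, with e the sign p(a,b). *)
Definition local (e : K) a b : Prop :=
  exists N : nat, iter N mul_zw (supercommutator e a b) = fun _ _ => 0.

Definition derivz (f : int -> (V -> V)) : int -> (V -> V) :=
  fun m => (m + 1)%:~R *: f (m + 1).

(* f(-z). *)
Definition subst_opp (f : int -> V) : int -> V := fun m => (-1) ^ m *: f m.

(* e^{zT} f(z), where e^{zT} = sum_k z^k T^k / k!.  For a Laurent series f the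
   family summed below has finite support (exp_support). *)
Definition exp_term T (f : int -> V) (m : int) (k : nat) : V :=
  (k`!%:R)^-1 *: iter k T (f (m - k%:Z)).

Definition expzT T (f : int -> V) : int -> V :=
  fun m => \sum_(k \in [set: nat]) exp_term T f m k.

Lemma exp_support T f m :
  laurent f -> finite_set [set k | exp_term T f m k != 0].
Proof.
move=> [N fN]; apply: (@sub_finite_set _ _ `I_(`|m - N|%N.+1));
  last exact: finite_II.
move=> k /= nz; rewrite ltnS; case: (leP N (m - k%:Z)) => [le|/fN f0].
  by rewrite -lez_nat; apply: le_trans (lez_abs _); rewrite lerBrDl -lerBrDr.
case/eqP: nz; rewrite /exp_term f0.
suff -> n : iter n T 0 = 0 by rewrite scaler0.
by elim: n => //= n ->; rewrite linear0.
Qed.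

Record is_vertex_algebra (vac : V) T (Y : V -> int -> {linear V -> V}) : Prop :=
  IsVertexAlgebra {
    vac_even : homog false vac;
    T_even : has_parity false T;
    Y_linear : forall (c : K) (a b : V) n v,
      Y (c *: a + b) n v = c *: Y a n v + Y b n v;
    Y_parity : forall i (a : V) n, homog i a -> has_parity i (Y a n);
    Y_field : forall a : V, is_field (Y a);
    Y_vac : dist (Y vac) = fun m => if m == 0 then (id : V -> V) else 0;
    Y_creation_lt0 : forall (a : V) m, m < 0 -> app (Y a) vac m = 0;
    Y_creation_0 : forall a : V, app (Y a) vac 0 = a;
    T_vac : T vac = 0;
    (* T is even, so its supercommutator with Y(a,z) is the commutator. *)
    Y_translation : forall a : V,
      (fun m => (T \o dist (Y a) m) - (dist (Y a) m \o T)) =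
      derivz (dist (Y a));
    Y_local : forall i j (a b : V), homog i a -> homog j b ->
      local (psign i j) (Y a) (Y b)
  }.

End FormalDistributions.

(* Main.v *)
Require Import Defs.
From mathcomp Require Import all_boot all_order all_algebra.
From mathcomp Require Import all_classical all_reals.
From mathcomp Require Import ring zify.
Local Open Scope ring_scope.

(** Skew-symmetry compares the products Y(a,z)b and Y(b,w)a, and both are
    visible in products applied to the vacuum: since Y(b,w)|0> = b + O(w), the
    series F(z,w) = Y(a,z)Y(b,w)|0> has constant term Y(a,z)b in w, and
    likewise G(z,w) = Y(b,w)Y(a,z)|0> has constant term Y(b,w)a in z.
    Locality gives an N for which
        H(z,w) := (z-w)^N F(z,w) = p(a,b) (z-w)^N G(z,w)  ([local_on_vector]).
    By creation F has no negative powers of w and G none of z, so H lies in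
    V[[z,w]], and setting one of the variables to zero is meaningful:
        H(z,0) = z^N Y(a,z)b,    H(0,w) = p(a,b) (-w)^N Y(b,w)a.

    The two restrictions are related by translation.  As T|0> = 0, the
    commutator [T,Y(a,z)] = dY(a,z)/dz gives T F = (d/dz + d/dw) F
    ([vacuum_product_translation]), and the factor z-w is killed by
    d/dz + d/dw, so T H = (d/dz + d/dw) H as well ([iter_mulzw_translation]).
    This differential equation determines H from H(0,w), namely
    H(z,w) = e^{zT} H(0,w-z); at w = 0 this reads H(z,0) = e^{zT} H(0,-z)
    ([translation_flow]).  Substituting the two restrictions and cancelling
    z^N is the theorem. *)

Set Implicit Arguments.
Unset Strict Implicit.
Unset Printing Implicit Defensive.
Import Order.TTheory GRing.Theory Num.Theory.

(** * Multiplication of two-variable distributions by z - w *)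

Section MultiplicationByDifference.
Variables (U : zmodType).
Implicit Types f g : int -> int -> U.

(** The operation [mul_zw] on coefficients in an arbitrary group, so that it
    applies to V-valued distributions too. *)
Definition mulzw f m n : U := f (m - 1) n - f m (n - 1).

Lemma iter_mulzwB N f g m n :
  iter N mulzw (fun p q => f p q - g p q) m n =
  iter N mulzw f m n - iter N mulzw g m n.
Proof.
elim: N m n => //= N IH m n; rewrite /mulzw !IH !opprB !addrA.
by rewrite [LHS](ACl (1*4*3*2)).
Qed.

Lemma iter_mulzw_lt0 N f m n :
  (forall p q, q < 0 -> f p q = 0) -> n < 0 -> iter N mulzw f m n = 0.
Proof.
move=> f0; elim: N m n => [|N IH] m n n0 /=; first exact: f0.
by rewrite /mulzw !IH ?subr0//; lia.
Qed.

(** Without negative powers of w one may set w = 0, where (z-w)^N is z^N. *)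
Lemma iter_mulzw_0 N f m :
  (forall p q, q < 0 -> f p q = 0) -> iter N mulzw f m 0 = f (m - N%:Z) 0.
Proof.
move=> f0; elim: N m => [|N IH] m /=; first by rewrite subr0.
rewrite /mulzw IH (iter_mulzw_lt0 _ _ f0)// subr0; congr f; lia.
Qed.

End MultiplicationByDifference.

Section MultiplicationScaling.
Variables (K : pzRingType) (U : lmodType K).
Implicit Types f : int -> int -> U.

(** (z-w)^N = (-1)^N (w-z)^N: this transfers to z the statements above about
    the variable w. *)
Lemma iter_mulzw_swap N f m n :
  iter N (@mulzw U) (fun p q => f q p) m n =
  (-1) ^+ N *: iter N (@mulzw U) f n m.
Proof.
elim: N m n => [|N IH] m n /=; first by rewrite expr0 scale1r.
by rewrite /mulzw !IH -scalerBr exprS mulN1r scaleNr -scalerN opprB.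
Qed.

Lemma iter_mulzwZ N c f m n :
  iter N (@mulzw U) (fun p q => c *: f p q) m n = c *: iter N (@mulzw U) f m n.
Proof. by elim: N m n => //= N IH m n; rewrite /mulzw !IH -scalerBr. Qed.

End MultiplicationScaling.

(** * The equation T H = (d/dz + d/dw) H *)

Section Translation.
Variables (K : numFieldType) (V : lmodType K) (T : {linear V -> V}).
Implicit Types f H : int -> int -> V.

Definition translation_covariant f := forall m n,
  T (f m n) = (m + 1)%:~R *: f (m + 1) n + (n + 1)%:~R *: f m (n + 1).

(** d/dz + d/dw is a derivation that annihilates z - w. *)
Lemma iter_mulzw_translation N f :
  translation_covariant f -> translation_covariant (iter N (@mulzw V) f).
Proof.
move=> fT; elim: N => //= N; move: (iter N _ f) => {fT} g gT m n.
rewrite /mulzw linearB !gT !addrK !scalerBr !intrD !scalerDl !scale1r.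
rewrite !opprD !addrA.
by rewrite [RHS](ACl (1*5*6*3*4*7*(2*8))) /= subrr addr0.
Qed.

Lemma iter_linearZ k c (v : V) : iter k T (c *: v) = c *: iter k T v.
Proof. by elim: k => //= k ->; rewrite linearZ. Qed.

(** The recursion says that the shift of the first index is T - S, where S is
    the shift of the second; S commutes with T, and the formula is the binomial
    expansion of (T - S)^m. *)
Lemma shift_recursion (g : nat -> nat -> V) :
  (forall m n, T (g m n) = g m.+1 n + g m n.+1) ->
  forall m n, g m n =
    \sum_(k < m.+1)
      ((-1) ^+ (m - k) *+ 'C(m, k)) *: iter k T (g 0 (n + (m - k))%N).
Proof.
move=> gT; elim=> [|m IH] n.
  by rewrite big_ord1 /= addn0 expr0 scale1r.
have -> : g m.+1 n = T (g m n) - g m n.+1 by rewrite gT addrK.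
rewrite (IH n) (IH n.+1) linear_sum.
rewrite [RHS]big_ord_recl -sumrN [X in _ + X = _]big_ord_recl.
rewrite [X in _ = _ + X](eq_bigr (fun k : 'I_m.+1 =>
  ((-1) ^+ (m - k) *+ 'C(m, k)) *: iter k.+1 T (g 0 (n + (m - k))%N) +
  ((-1) ^+ (m - k) *+ 'C(m, k.+1)) *: iter k.+1 T (g 0 (n + (m - k))%N)));
  last first.
  by move=> k _; rewrite lift0 binS subSS mulrnDr scalerDl addrC.
rewrite [in RHS]big_split /= [RHS]addrCA; congr (_ + _).
  by apply: eq_bigr => k _; rewrite linearZ.
rewrite !subn0 !bin0 addnS addSn [in RHS]big_ord_recr /= bin_small//.
rewrite mulr0n scale0r addr0; congr (_ + _).
  by rewrite exprS mulN1r scaleNr.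
apply: eq_bigr => k _; rewrite /bump /= !add1n.
have -> : (m - k = (m - k.+1).+1)%N by have := ltn_ord k; lia.
by rewrite exprS mulN1r mulNrn scaleNr addnS addSn.
Qed.

(** This is H(z,0) = e^{zT} H(0,-z).  Multiplying the coefficient of z^m w^n by
    m! n! turns the derivatives into index shifts. *)
Lemma translation_flow H (m : nat) :
  translation_covariant H ->
  H m 0 = \sum_(k < m.+1)
    ((k`!)%:R^-1 * (-1) ^+ (m - k)) *: iter k T (H 0 (m - k)%N).
Proof.
move=> HT; pose g m n : V := (m`! * n`!)%:R *: H (Posz m) (Posz n).
have gT p q : T (g p q) = g p.+1 q + g p q.+1.
  have pS (k : nat) : k%:Z + 1 = k.+1 by lia.
  rewrite /g linearZ_LR HT scalerDr !scalerA !pS.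
  by congr (_ *: _ + _ *: _); rewrite -natrM ?factS; congr (_%:R); lia.
have f0 n : (n`!)%:R != 0 :> K by rewrite pnatr_eq0 -lt0n fact_gt0.
have := shift_recursion gT m 0; rewrite /g fact0 muln1 => e.
apply: (scalerI (f0 m)); rewrite e scaler_sumr; apply: eq_bigr => k _.
rewrite iter_linearZ !scalerA add0n mul1n; congr (_ *: _).
have /bin_fact <- : (k <= m)%N by have := ltn_ord k; lia.
by rewrite !natrM mulr_natr -mulr_natr; field.
Qed.

End Translation.

Lemma expzT_ord (K : fieldType) (V : superspace K) (T : {linear V -> V})
    (f : int -> V) (m : int) (n : nat) :
  (forall k : nat, (n <= k)%N -> f (m - k%:Z) = 0) ->
  expzT T f m = \sum_(k < n) exp_term T f m k.
Proof.
move=> f0; rewrite /expzT fsbig_ord; apply/esym/fsbig_widen => // k [_ /=].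
move=> /negP; rewrite -leqNgt => nk; rewrite /exp_term f0//.
suff -> : iter k T 0 = 0 by rewrite scaler0.
by elim: k {nk} => //= k ->; rewrite linear0.
Qed.

(** * Products of two fields applied to the vacuum *)

Section LocalOnVector.
Variables (K : fieldType) (V : superspace K).

Lemma iter_mul_zwE N (f : int -> int -> V -> V) v m n :
  iter N (@mul_zw K V) f m n v = iter N (@mulzw V) (fun p q => f p q v) m n.
Proof. by elim: N m n => //= N IH m n; rewrite /mulzw -!IH. Qed.

Lemma local_on_vector e (a b : int -> {linear V -> V}) v :
  local e a b -> exists N : nat, forall m n,
  iter N (@mulzw V) (fun p q => dist a p (dist b q v)) m n =
  e *: iter N (@mulzw V) (fun p q => dist b q (dist a p v)) m n.
Proof.
move=> [N abN]; exists N => m n.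
have := congr1 (fun f => f m n v) abN; rewrite iter_mul_zwE.
rewrite -[LHS]/(iter N (@mulzw V) (fun p q =>
  dist a p (dist b q v) - e *: dist b q (dist a p v)) m n).
by rewrite iter_mulzwB iter_mulzwZ => /eqP; rewrite subr_eq0 => /eqP.
Qed.

End LocalOnVector.

Section VertexAlgebra.
Variables (K : numFieldType) (V : superspace K).
Variables (vac : V) (T : {linear V -> V}) (Y : V -> int -> {linear V -> V}).
Hypothesis hV : is_vertex_algebra vac T Y.

Lemma translation_dist a m v :
  T (dist (Y a) m v) =
  dist (Y a) m (T v) + (m + 1)%:~R *: dist (Y a) (m + 1) v.
Proof.
have /(congr1 (fun f => f m v)) /eqP := Y_translation hV a.
by rewrite subr_eq addrC => /eqP eTY; apply: etrans eTY _.
Qed.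

Lemma vacuum_product_translation a b :
  translation_covariant T (fun m n => dist (Y a) m (dist (Y b) n vac)).
Proof.
move=> m n; rewrite !translation_dist (T_vac hV) /dist.
by rewrite linear0 add0r linearZ /= addrC.
Qed.

Theorem skew_symmetry i j a b (m : int) : homog i a -> homog j b ->
  app (Y a) b m = psign K i j *: expzT T (subst_opp (app (Y b) a)) m.
Proof.
move=> ha hb; have [N NE] := local_on_vector vac (Y_local hV ha hb).
pose A := dist (Y a); pose B := dist (Y b).
pose H := iter N (@mulzw V) (fun m n => A m (B n vac)).
set e := psign K i j in NE *.
have ee : e * e = 1 by rewrite /e /psign -expr2 sqrr_sign.
have Y0 c n : n < 0 -> dist (Y c) n vac = 0 by exact: (Y_creation_lt0 hV).
have Yc c : dist (Y c) 0 vac = c by exact: (Y_creation_0 hV).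
have A0 p q : q < 0 -> A p (B q vac) = 0.
  by move=> q0; rewrite /A /B Y0 // /dist linear0.
have B0 p q : q < 0 -> B p (A q vac) = 0.
  by move=> q0; rewrite /A /B Y0 // /dist linear0.
have HT : translation_covariant T H.
  exact/iter_mulzw_translation/vacuum_product_translation.
have HA p : H p 0 = A (p - N%:Z) b by rewrite /H iter_mulzw_0// /B Yc.
have Hswap p q : H p q =
    (e * (-1) ^+ N) *: iter N (@mulzw V) (fun q p => B q (A p vac)) q p.
  by rewrite /H NE (iter_mulzw_swap N (fun q p => B q (A p vac))) scalerA.
have H0 p q : p < 0 -> H p q = 0.
  by move=> p0; rewrite Hswap iter_mulzw_lt0// scaler0.
have HB n : B n a = (e * (-1) ^+ N) *: H 0 (n + N%:Z).
  rewrite Hswap iter_mulzw_0// addrK /A Yc scalerA.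
  by rewrite mulrACA ee mul1r -expr2 sqrr_sign scale1r.
(* H has no negative powers of w, so N also bounds the pole of Y(b,w)a; this
   makes the exponential sum finite. *)
have HB0 n : n + N%:Z < 0 -> B n a = 0.
  by move=> n0; rewrite HB /H iter_mulzw_lt0// scaler0.
rewrite -[app _ _ _]/(A m b).
have mE : m = m + N%:Z - N%:Z by rewrite addrK.
rewrite {1}mE -HA; case: (ltP (m + N%:Z) 0) => [mN0|].
  rewrite H0// (@expzT_ord _ _ _ _ _ 0) ?big_ord0 ?scaler0// => k _.
  by rewrite /subst_opp -[app _ _ _]/(B _ a) HB0 ?scaler0//; lia.
case E: (m + N%:Z) => [p|//] _.
rewrite (@expzT_ord _ _ _ _ _ p.+1) => [|k pk]; last first.
  by rewrite /subst_opp -[app _ _ _]/(B _ a) HB0 ?scaler0//; lia.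
rewrite (translation_flow _ HT) scaler_sumr; apply: eq_bigr => k _.
have kp : (k <= p)%N by have := ltn_ord k; lia.
rewrite /exp_term /subst_opp -[app _ _ _]/(B _ a) HB !iter_linearZ !scalerA.
have -> : m - k%:Z + N%:Z = (p - k)%N by lia.
congr (_ *: _).
have -> : (-1) ^+ (p - k) = (-1) ^ (m - k%:Z) * (-1) ^+ N :> K.
  rewrite !exprnP -expfzDr ?oppr_eq0 ?oner_eq0//; congr (_ ^ _); lia.
by rewrite [RHS](AC (2*(1*2)) ((1*4)*(2*(3*5)))) /= ee mul1r.
Qed.

End VertexAlgebra.

Unset Implicit Arguments.

Theorem theorem4p4p1 (R : realType) (V : superspace R[i])
    (vac : V) (T : {linear V -> V}) (Y : V -> int -> {linear V -> V})
    (hV : is_vertex_algebra vac T Y)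
    (i j : bool) (a b : V) (ha : homog i a) (hb : homog j b) :
  app (Y a) b =
  (fun m : int => psign _ i j *: expzT T (subst_opp (app (Y b) a)) m).
Proof. by apply/funext => m; exact: skew_symmetry hV _ _ _ _ m ha hb. Qed.
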